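(* Let $m\ge1$, let $a_1<a_2<\cdots<a_{m+1}$ be real numbers, and let $f_i:[a_i,a_{i+1}]\to\mathbb{R}$ be a continuous strictly monotone function for $i=1,\dots,m$. Let $f:[a_1,a_{m+1}]\to\mathbb{R}$ be the piecewise-continuous function given by $f(x):=f_i(x)$ for $x\in(a_i,a_{i+1})$, $i=1,\dots,m$, with $f(a_1)=f_1(a_1)$ and $f(a_{m+1})=f_m(a_{m+1})$. Let $b_1\in f_1([a_1,a_2])$ and $b_{m+1}\in f_m([a_m,a_{m+1}])$, and write $f^{-1}(b_1):=f_1^{-1}(b_1)\in[a_1,a_2]$ and $f^{-1}(b_{m+1}):=f_m^{-1}(b_{m+1})\in[a_m,a_{m+1}]$. Set $$ F(b_1,b_{m+1}):=\int_{a_1}^{a_{m+1}} f(x)\,dx + \int_{b_1}^{b_{m+1}} f^{-1}(y)\,dy - a_{m+1}b_{m+1} + a_1b_1+\sum_{i=2}^{m}a_i\left[f_i(a_i)-f_{i-1}(a_i)\right], $$ $$ K_i:=\left(a_i-f^{-1}(b_i)\right)\left(f(a_i)-b_i\right),\quad i\in\{1,m+1\}. $$ Then: (i) If $f_1$ and $f_m$ are both strictly increasing, then $-K_1\le F(b_1,b_{m+1})\le K_{m+1}$. The inequalities are reversed if $f_1$ and $f_m$ are both strictly decreasing. (ii) If $f_1$ is strictly increasing and $f_m$ is strictly decreasing, then $K_{m+1}-K_1\le F(b_1,b_{m+1})\le 0$. The inequalities are reversed if $f_1$ is strictly decreasing and $f_m$ is strictly increasing. In all cases, the equalities hold if and only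 if $b_1=f(a_1)$ and $b_{m+1}=f(a_{m+1})$.
   Context: Here $f^{-1}$ denotes the piecewise inverse ($f^{-1}=f_i^{-1}$ on the range of the $i$-th piece), and its integral is taken branch by branch along the pieces: for $m\ge2$, $$\int_{b_1}^{b_{m+1}} f^{-1}(y)\,dy := \int_{b_1}^{f_1(a_2)} f_1^{-1}(y)\,dy+\sum_{i=2}^{m-1}\int_{f_i(a_i)}^{f_i(a_{i+1})} f_i^{-1}(y)\,dy+\int_{f_m(a_m)}^{b_{m+1}} f_m^{-1}(y)\,dy,$$ and for $m=1$ it is $\int_{b_1}^{b_2}f_1^{-1}(y)\,dy$. Integrals are oriented ($\int_r^s=-\int_s^r$). *)

(* Defs.v *)
From Stdlib Require Import Reals Arith ClassicalEpsilon.
From Coquelicot Require Import Coquelicot.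
Open Scope R_scope.

Definition strictly_increasing_on (lo hi : R) (g : R -> R) : Prop :=
  forall x y : R, lo <= x -> x < y -> y <= hi -> g x < g y.

Definition strictly_decreasing_on (lo hi : R) (g : R -> R) : Prop :=
  forall x y : R, lo <= x -> x < y -> y <= hi -> g y < g x.

Definition strictly_monotone_on (lo hi : R) (g : R -> R) : Prop :=
  strictly_increasing_on lo hi g \/ strictly_decreasing_on lo hi g.

Definition in_image (lo hi : R) (g : R -> R) (y : R) : Prop :=
  exists x : R, lo <= x <= hi /\ g x = y.

(* The inverse of the restriction of [g] to [lo, hi]; its value is unspecified
   outside the image g([lo, hi]). *)
Definition inverse_on (lo hi : R) (g : R -> R) (y : R) : R :=
  epsilon (inhabits 0) (fun x : R => lo <= x <= hi /\ g x = y).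

(* Pieces are indexed by 1..m and breakpoints by 1..m+1: [p i] lives on
   [a i, a (S i)], and values of [a] and [p] at other indices are never used. *)

(* [f] is left unconstrained at the interior breakpoints a 2, ..., a m. *)
Definition is_piecewise (m : nat) (a : nat -> R) (p : nat -> R -> R)
    (f : R -> R) : Prop :=
  (forall (i : nat) (x : R), (1 <= i <= m)%nat ->
     a i < x < a (S i) -> f x = p i x) /\
  f (a 1%nat) = p 1%nat (a 1%nat) /\
  f (a (S m)) = p m (a (S m)).

Definition piece_inv (a : nat -> R) (p : nat -> R -> R) (i : nat) : R -> R :=
  inverse_on (a i) (a (S i)) (p i).

(* [RInt] is oriented, and [sum_n_m u j k] is 0 when k < j (so the middle sum
   is empty for m = 2). *)
Definition RInt_piecewise_inv (m : nat) (a : nat -> R) (p : nat -> R -> R)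
    (b1 bm1 : R) : R :=
  if Nat.eqb m 1 then RInt (piece_inv a p 1%nat) b1 bm1
  else
    RInt (piece_inv a p 1%nat) b1 (p 1%nat (a 2%nat))
    + sum_n_m (fun i : nat =>
        RInt (piece_inv a p i) (p i (a i)) (p i (a (S i)))) 2 (m - 1)
    + RInt (piece_inv a p m) (p m (a m)) bm1.

Definition young_F (m : nat) (a : nat -> R) (p : nat -> R -> R) (f : R -> R)
    (b1 bm1 : R) : R :=
  RInt f (a 1%nat) (a (S m))
  + RInt_piecewise_inv m a p b1 bm1
  - a (S m) * bm1 + a 1%nat * b1
  + sum_n_m (fun i : nat =>
      a i * (p i (a i) - p (i - 1)%nat (a i))) 2 m.

(* Main.v *)
(** For a strictly monotone continuous [g] one has
    [RInt g^-1 (g u) (g v) = v * g v - u * g u - RInt g u v].  Applied to every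
    piece, this collapses [young_F] to [A + B] with
    [A = int_{a_1}^{c_1} (f_1 - b_1)] and
    [B = int_{c_m}^{a_{m+1}} (f_m - b_{m+1})], where [c_1], [c_m] are the
    preimages of [b_1], [b_{m+1}].  Monotonicity of [f_1] puts [A] between [0]
    and [- K_1], that of [f_m] puts [B] between [0] and [K_{m+1}], strictly
    unless the interval of integration is degenerate. *)

Require Import Defs.
From Stdlib Require Import Reals Arith.
From Coquelicot Require Import Coquelicot.
From Stdlib Require Import Lra Lia ClassicalEpsilon.
Open Scope R_scope.

(** * Increasing functions on the whole line and the integral of their inverse *)

Lemma RInt_increasing_strict_bounds (g : R -> R) (u v : R) :
  (forall x, continuous g x) -> (forall x y, x < y -> g x < g y) -> u < v ->
  (v - u) * g u < RInt g u v < (v - u) * g v.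
Proof.
  intros Hc Hi Huv.
  assert (Hk : forall k : R, RInt (fun _ => k) u v = (v - u) * k)
    by (intros k; exact (RInt_const u v k)).
  rewrite <- !Hk; split; apply RInt_lt; auto;
    try (intros; apply continuous_const); intros x Hx; apply Hi; lra.
Qed.

(** Swapping [u] and [v] negates both the length and the integral, so the bounds survive reversed
    orientation. This spares the difference quotient below a case split on the sign of the
    increment. *)
Lemma RInt_increasing_bounds (g : R -> R) (u v : R) :
  (forall x, continuous g x) -> (forall x y, x < y -> g x < g y) ->
  (v - u) * g u <= RInt g u v <= (v - u) * g v.
Proof.
  intros Hc Hi.
  destruct (Rtotal_order u v) as [H | [<- | H]].
  - pose proof (RInt_increasing_strict_bounds g u v Hc Hi H); lra.
  - rewrite RInt_point; change (@zero R_CompleteNormedModule) with 0; lra.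
  - pose proof (RInt_increasing_strict_bounds g v u Hc Hi H).
    rewrite <- (opp_RInt_swap g v u)
      by (apply ex_RInt_continuous; intros; apply Hc).
    change (@opp R_CompleteNormedModule) with Ropp; lra.
Qed.

(** A strictly increasing [g] reflects the order, so [h] sends the open interval from
    [g (h y - eps)] to [g (h y + eps)], which contains [y], into the [eps]-ball around [h y]. *)
Lemma increasing_inverse_continuous (g h : R -> R) :
  (forall x y, x < y -> g x < g y) -> (forall y, g (h y) = y) ->
  forall y, continuous h y.
Proof.
  intros Hi Hh y.
  apply continuity_pt_filterlim, continuity_pt_locally; intros eps.
  assert (Hm : forall x z, g x < g z -> x < z).
  { intros x z H; destruct (Rtotal_order x z) as [L | [-> | L]]; auto;
      [lra | apply Hi in L; lra]. }
  pose proof (cond_pos eps) as He.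
  assert (L1 : g (h y - eps) < y) by (rewrite <- (Hh y) at 2; apply Hi; lra).
  assert (L2 : y < g (h y + eps)) by (rewrite <- (Hh y) at 1; apply Hi; lra).
  assert (Hd : 0 < Rmin (y - g (h y - eps)) (g (h y + eps) - y))
    by (apply Rmin_pos; lra).
  exists (mkposreal _ Hd); intros z Hz.
  change (Rabs (z - y) < Rmin (y - g (h y - eps)) (g (h y + eps) - y)) in Hz.
  pose proof (Rmin_l (y - g (h y - eps)) (g (h y + eps) - y)).
  pose proof (Rmin_r (y - g (h y - eps)) (g (h y + eps) - y)).
  apply Rabs_def2 in Hz.
  assert (h y - eps < h z) by (apply Hm; rewrite Hh; lra).
  assert (h z < h y + eps) by (apply Hm; rewrite Hh; lra).
  apply Rabs_def1; lra.
Qed.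

(* [g] need not be differentiable: monotonicity alone squeezes the increment
   of [y * h y - RInt g 0 (h y)] between [h y * (z - y)] and [h z * (z - y)]. *)
Lemma is_derive_inverse_primitive (g h : R -> R) :
  (forall x, continuous g x) -> (forall x y, x < y -> g x < g y) ->
  (forall y, g (h y) = y) ->
  forall y, is_derive (fun z => z * h z - RInt g 0 (h z)) y (h y).
Proof.
  intros Hc Hi Hh y.
  apply is_derive_Reals; intros eps Heps.
  pose proof (increasing_inverse_continuous g h Hi Hh y) as Hcont.
  apply continuity_pt_filterlim in Hcont.
  apply continuity_pt_locally with (eps := mkposreal eps Heps) in Hcont.
  destruct Hcont as [d Hd]; exists d; intros k Hk Hkd.
  assert (Hnear : Rabs (h (y + k) - h y) < eps).
  { apply Hd; change (Rabs (y + k - y) < d).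
    now replace (y + k - y) with k by ring. }
  assert (Hch : RInt g 0 (h (y + k))
                = RInt g 0 (h y) + RInt g (h y) (h (y + k))).
  { symmetry; apply (RInt_Chasles g); apply ex_RInt_continuous; auto. }
  pose proof (RInt_increasing_bounds g (h y) (h (y + k)) Hc Hi) as [B1 B2].
  rewrite Hh in B1, B2.
  rewrite Hch.
  (* [D] is the increment of the candidate primitive. Both [D - h y * k] and its upper bound are
     nonnegative for either sign of [k], so after division by [Rabs k] the error is at most
     [Rabs (h (y + k) - h y)], which is below [eps]. *)
  set (D := (y + k) * h (y + k) - (RInt g 0 (h y) + RInt g (h y) (h (y + k)))
            - (y * h y - RInt g 0 (h y))).
  assert (D1 : 0 <= D - h y * k) by (unfold D; nra).
  assert (D2 : D - h y * k <= (h (y + k) - h y) * k) by (unfold D; nra).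
  replace (D / k - h y) with ((D - h y * k) / k) by (field; auto).
  rewrite Rabs_div by auto.
  apply Rle_lt_trans with (2 := Hnear).
  apply Rle_div_l; [now apply Rabs_pos_lt |].
  rewrite <- Rabs_mult, !Rabs_pos_eq; lra.
Qed.

(** This is the fundamental theorem of calculus for the primitive above. Injectivity of [g] makes
    the right inverse [h] a left inverse too, which evaluates the primitive at [g u] and [g v]. *)
Lemma RInt_increasing_inverse (g h : R -> R) (u v : R) :
  (forall x, continuous g x) -> (forall x y, x < y -> g x < g y) ->
  (forall y, g (h y) = y) ->
  is_RInt h (g u) (g v) (v * g v - u * g u - RInt g u v).
Proof.
  intros Hc Hi Hh.
  assert (Hhg : forall x, h (g x) = x).
  { intros x; destruct (Rtotal_order (h (g x)) x) as [L | [E | L]]; auto;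
      apply Hi in L; rewrite Hh in L; lra. }
  replace (v * g v - u * g u - RInt g u v) with
    (minus (g v * h (g v) - RInt g 0 (h (g v)))
           (g u * h (g u) - RInt g 0 (h (g u)))).
  - apply (is_RInt_derive (fun z => z * h z - RInt g 0 (h z))); intros y _.
    + now apply is_derive_inverse_primitive.
    + now apply (increasing_inverse_continuous g).
  - rewrite !Hhg.
    assert (Hch : RInt g 0 v = RInt g 0 u + RInt g u v).
    { symmetry; apply (RInt_Chasles g); apply ex_RInt_continuous; auto. }
    rewrite Hch; unfold minus, plus, opp; simpl; ring.
Qed.

(** * Projection onto an interval and extension of functions to the line *)

Definition clamp (lo hi x : R) : R := Rmax lo (Rmin hi x).

Lemma clamp_spec (lo hi x : R) : lo <= hi ->
  (x <= lo /\ clamp lo hi x = lo) \/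
  (lo <= x <= hi /\ clamp lo hi x = x) \/
  (hi <= x /\ clamp lo hi x = hi).
Proof.
  intros H; unfold clamp, Rmax, Rmin.
  destruct (Rle_dec hi x); destruct (Rle_dec lo _); lra.
Qed.

Lemma clamp_continuous (lo hi x : R) : lo <= hi ->
  continuous (clamp lo hi) x.
Proof.
  intros H; apply continuity_pt_filterlim, continuity_pt_locally.
  (* The projection is 1-Lipschitz, so [eps] itself serves as the radius. *)
  intros eps; exists eps; intros z Hz.
  change (Rabs (z - x) < eps) in Hz.
  apply Rle_lt_trans with (2 := Hz).
  destruct (clamp_spec lo hi x H) as [[? ->] | [[? ->] | [? ->]]];
  destruct (clamp_spec lo hi z H) as [[? ->] | [[? ->] | [? ->]]];
  unfold Rabs; repeat destruct Rcase_abs; lra.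
Qed.

(** The clamp takes values in the interval only, so the relative limits supplied by [continuous_on]
    suffice. *)
Lemma continuous_clamped (lo hi : R) (g : R -> R) : lo <= hi ->
  continuous_on (fun x => lo <= x <= hi) g ->
  forall x, continuous (fun z => g (clamp lo hi z)) x.
Proof.
  intros H Hg x.
  assert (Hin : forall z, lo <= clamp lo hi z <= hi)
    by (intros z;
        destruct (clamp_spec lo hi z H) as [[? ->] | [[? ->] | [? ->]]]; lra).
  eapply filterlim_comp; [| apply (Hg (clamp lo hi x)), Hin].
  intros P HP; unfold within in HP.
  apply (clamp_continuous lo hi x H) in HP.
  unfold filtermap in *; revert HP; apply filter_imp; auto.
Qed.

(** Continuing [g] by half-lines of slope 1 on both sides keeps it continuous and strictly
    increasing and makes it surjective. The whole-line results then apply to a function given on an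
    interval. *)
Lemma increasing_extension (lo hi : R) (g : R -> R) :
  lo <= hi -> continuous_on (fun x => lo <= x <= hi) g ->
  strictly_increasing_on lo hi g ->
  exists G h : R -> R,
    (forall x, continuous G x) /\ (forall x y, x < y -> G x < G y) /\
    (forall y, G (h y) = y) /\ (forall x, lo <= x <= hi -> G x = g x).
Proof.
  intros H Hc Hi.
  set (G := fun x => g (clamp lo hi x) + (x - clamp lo hi x)).
  assert (HGc : forall x, continuous G x).
  { intros x; apply (continuous_plus (V := R_NormedModule)).
    - now apply continuous_clamped.
    - apply (continuous_minus (V := R_NormedModule));
        [apply continuous_id | now apply clamp_continuous]. }
  assert (HGi : forall x y, x < y -> G x < G y).
  { intros x y L; unfold G.
    destruct (clamp_spec lo hi x H) as [[? ->] | [[? ->] | [? ->]]];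
    destruct (clamp_spec lo hi y H) as [[? ->] | [[? ->] | [? ->]]];
    try lra;
    (* The clamped values [s <= t] may coincide; the slope-one terms then give the strict
       inequality. *)
    match goal with |- g ?s + _ < g ?t + _ =>
      destruct (Rle_lt_or_eq_dec s t ltac:(lra)) as [Q | Q];
      [pose proof (Hi s t ltac:(lra) Q ltac:(lra)); lra | rewrite Q; lra] end. }
  assert (HGs : forall y, exists x, G x = y).
  { intros y.
    (* Moving out along the slope-one tails by the distance from [y] to the end value is enough to
       bracket [y]. *)
    set (u := lo - Rabs (y - g lo)); set (v := hi + Rabs (y - g hi)).
    pose proof (Rle_abs (y - g hi)); pose proof (Rabs_pos (y - g hi)).
    pose proof (Rabs_maj2 (y - g lo)); pose proof (Rabs_pos (y - g lo)).
    assert (G u <= y).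
    { unfold G, u.
      destruct (clamp_spec lo hi (lo - Rabs (y - g lo)) H)
        as [[? ->] | [[? ->] | [? ->]]]; try lra.
      - replace (lo - Rabs (y - g lo)) with lo by lra; lra.
      - replace hi with lo by lra; lra. }
    assert (y <= G v).
    { unfold G, v.
      destruct (clamp_spec lo hi (hi + Rabs (y - g hi)) H)
        as [[? ->] | [[? ->] | [? ->]]]; try lra.
      - replace lo with hi by lra; lra.
      - replace (hi + Rabs (y - g hi)) with hi by lra; lra. }
    destruct (IVT_gen_consistent G u v y HGc) as [x [_ Hx]]; [| now exists x].
    pose proof (Rmin_l (G u) (G v)); pose proof (Rmax_r (G u) (G v)); lra. }
  set (h := fun y => epsilon (inhabits 0) (fun x => G x = y)).
  assert (Hh : forall y, G (h y) = y)
    by (intros y; exact (epsilon_spec (inhabits 0) (fun x => G x = y) (HGs y))).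
  exists G, h; repeat split; auto.
  intros x Hx; unfold G.
  destruct (clamp_spec lo hi x H) as [[? ->] | [[? ->] | [? ->]]]; try lra.
  - replace x with lo by lra; lra.
  - replace x with hi by lra; lra.
Qed.

Lemma ex_RInt_continuous_on (lo hi u v : R) (g : R -> R) :
  continuous_on (fun x => lo <= x <= hi) g ->
  lo <= u <= hi -> lo <= v <= hi -> ex_RInt g u v.
Proof.
  intros Hc Hu Hv.
  apply ex_RInt_ext with (fun x => g (clamp lo hi x)).
  - intros x Hx.
    assert (lo <= x <= hi)
      by (revert Hx; unfold Rmin, Rmax; destruct Rle_dec; lra).
    destruct (clamp_spec lo hi x) as [[? ->] | [[? ->] | [? ->]]]; try lra;
      f_equal; lra.
  - apply (ex_RInt_continuous (V := R_CompleteNormedModule)).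
    intros; apply continuous_clamped; auto; lra.
Qed.

(** * The inverse on an interval and its integral *)

Lemma inverse_on_spec (lo hi : R) (g : R -> R) (y : R) :
  in_image lo hi g y ->
  lo <= inverse_on lo hi g y <= hi /\ g (inverse_on lo hi g y) = y.
Proof. intros H; unfold inverse_on; now apply epsilon_spec. Qed.

Lemma strictly_monotone_on_inj (lo hi : R) (g : R -> R) (x y : R) :
  strictly_monotone_on lo hi g -> lo <= x <= hi -> lo <= y <= hi ->
  g x = g y -> x = y.
Proof.
  intros Hm Hx Hy E.
  destruct (Rtotal_order x y) as [L | [L | L]]; auto; exfalso;
    destruct Hm as [Hm | Hm];
    [pose proof (Hm x y) | pose proof (Hm x y) |
     pose proof (Hm y x) | pose proof (Hm y x)]; lra.
Qed.

Lemma continuous_on_opp (lo hi : R) (g : R -> R) :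
  continuous_on (fun x => lo <= x <= hi) g ->
  continuous_on (fun x => lo <= x <= hi) (fun x => - g x).
Proof.
  intros Hc x Hx; eapply filterlim_comp; [exact (Hc x Hx) |].
  exact (filterlim_opp (V := R_NormedModule) (g x)).
Qed.

Lemma RInt_Ropp (g : R -> R) (u v : R) :
  ex_RInt g u v -> RInt (fun x => - g x) u v = - RInt g u v.
Proof. exact (RInt_opp g u v). Qed.

(** The left inverse [k] is left general because the decreasing case supplies a reflected inverse
    instead of [inverse_on] for the function at hand. *)
Lemma RInt_increasing_on_inverse (lo hi : R) (g k : R -> R) (u v : R) :
  continuous_on (fun x => lo <= x <= hi) g ->
  strictly_increasing_on lo hi g ->
  lo <= u <= hi -> lo <= v <= hi ->
  (forall x, lo <= x <= hi -> k (g x) = x) ->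
  is_RInt k (g u) (g v) (v * g v - u * g u - RInt g u v).
Proof.
  intros Hc Hi Hu Hv Hk.
  destruct (increasing_extension lo hi g ltac:(lra) Hc Hi)
    as (G & h & HGc & HGi & Hh & HG).
  pose proof (RInt_increasing_inverse G h u v HGc HGi Hh) as E.
  rewrite (RInt_ext G g u v) in E.
  2:{ intros x Hx; apply HG.
      revert Hx; unfold Rmin, Rmax; destruct Rle_dec; lra. }
  rewrite !HG in E by auto.
  (* Strictly between [g u] and [g v], order reflection puts [h y] inside the interval, where [G] is
     [g]; hence [k] agrees with [h] there. *)
  revert E; apply is_RInt_ext; intros y Hy.
  assert (HGm : forall x z, G x < G z -> x < z).
  { intros x z L; destruct (Rtotal_order x z) as [L' | [-> | L']]; auto;
      [lra | apply HGi in L'; lra]. }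
  assert (Hy' : lo < h y < hi).
  { rewrite <- (HG u Hu), <- (HG v Hv) in Hy.
    revert Hy; unfold Rmin, Rmax; destruct Rle_dec; intros [L1 L2];
      rewrite <- (Hh y) in L1, L2; apply HGm in L1; apply HGm in L2; lra. }
  rewrite <- (Hh y) at 2; rewrite HG, Hk; lra.
Qed.

Lemma RInt_inverse_on (lo hi : R) (g : R -> R) (u v : R) :
  continuous_on (fun x => lo <= x <= hi) g ->
  strictly_monotone_on lo hi g ->
  lo <= u <= hi -> lo <= v <= hi ->
  RInt (inverse_on lo hi g) (g u) (g v) = v * g v - u * g u - RInt g u v.
Proof.
  intros Hc Hm Hu Hv.
  assert (Hk : forall x, lo <= x <= hi -> inverse_on lo hi g (g x) = x).
  { intros x Hx.
    destruct (inverse_on_spec lo hi g (g x)) as [H1 H2]; [now exists x |].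
    now apply (strictly_monotone_on_inj lo hi g). }
  apply is_RInt_unique; destruct Hm as [Hi | Hd].
  - now apply (RInt_increasing_on_inverse lo hi).
  (* For decreasing [g], the function [- g] is increasing with inverse
     [y => inverse_on lo hi g (- y)]. The substitution of [- y] for [y] brings the integral back;
     the double negations below give the integrand the shape this substitution produces. *)
  - pose proof (RInt_increasing_on_inverse lo hi (fun x => - g x)
      (fun y => inverse_on lo hi g (- y)) u v) as E.
    apply is_RInt_ext
      with (fun y => opp (opp (inverse_on lo hi g (- - y)))).
    { intros y _; rewrite opp_opp; f_equal; ring. }
    replace (v * g v - u * g u - RInt g u v)
      with (opp (v * - g v - u * - g u - RInt (fun x => - g x) u v)).
    2:{ rewrite RInt_Ropp by now apply (ex_RInt_continuous_on lo hi).
        unfold opp; simpl; ring. }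
    apply (is_RInt_opp (V := R_NormedModule)
             (fun y => opp (inverse_on lo hi g (- - y)))).
    apply (is_RInt_comp_opp (fun y => inverse_on lo hi g (- y))).
    apply E; auto.
    + now apply continuous_on_opp.
    + intros x y ? ? ?; apply Ropp_lt_contravar, Hd; auto.
    + intros x Hx; rewrite Ropp_involutive; auto.
Qed.

(** * Strict integral bounds on a monotone piece *)

Lemma RInt_increasing_on_bounds (lo hi u v : R) (g : R -> R) :
  continuous_on (fun x => lo <= x <= hi) g ->
  strictly_increasing_on lo hi g -> lo <= u -> u < v -> v <= hi ->
  (v - u) * g u < RInt g u v < (v - u) * g v.
Proof.
  intros Hc Hi Hu Huv Hv.
  destruct (increasing_extension lo hi g ltac:(lra) Hc Hi)
    as (G & h & HGc & HGi & _ & HG).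
  pose proof (RInt_increasing_strict_bounds G u v HGc HGi Huv) as E.
  rewrite (RInt_ext G g u v) in E.
  2:{ rewrite Rmin_left, Rmax_right by lra; intros; apply HG; lra. }
  now rewrite !HG in E by lra.
Qed.

Lemma RInt_decreasing_on_bounds (lo hi u v : R) (g : R -> R) :
  continuous_on (fun x => lo <= x <= hi) g ->
  strictly_decreasing_on lo hi g -> lo <= u -> u < v -> v <= hi ->
  (v - u) * g v < RInt g u v < (v - u) * g u.
Proof.
  intros Hc Hd Hu Huv Hv.
  pose proof (RInt_increasing_on_bounds lo hi u v (fun x => - g x)
    (continuous_on_opp lo hi g Hc)) as E.
  rewrite RInt_Ropp in E by (apply (ex_RInt_continuous_on lo hi); auto; lra).
  destruct E; auto; [| lra].
  intros x y ? ? ?; apply Ropp_lt_contravar, Hd; auto.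
Qed.

(** * Summation over the pieces *)

Lemma RInt_piecewise (m : nat) (a : nat -> R) (p : nat -> R -> R) (f : R -> R) :
  (1 <= m)%nat ->
  (forall i, (1 <= i <= m)%nat -> a i < a (S i)) ->
  (forall i, (1 <= i <= m)%nat -> ex_RInt (p i) (a i) (a (S i))) ->
  (forall i x, (1 <= i <= m)%nat -> a i < x < a (S i) -> f x = p i x) ->
  is_RInt f (a 1%nat) (a (S m))
    (sum_n_m (fun i => RInt (p i) (a i) (a (S i))) 1 m).
Proof.
  intros Hm; induction Hm as [| n Hn IH]; intros Ha Hp Hf.
  - rewrite sum_n_n.
    (* [is_RInt_ext] asks for agreement on the open interval only, which is what the hypothesis on
       [f] gives. *)
    apply is_RInt_ext with (p 1%nat); [| apply (RInt_correct (p _)), Hp; lia].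
    pose proof (Ha 1%nat ltac:(lia)).
    rewrite Rmin_left, Rmax_right by lra.
    intros x Hx; symmetry; apply Hf; auto; lia.
  - rewrite sum_n_Sm by lia.
    apply (is_RInt_Chasles (V := R_NormedModule)) with (a (S n)).
    + apply IH; intros; try apply Ha; try apply Hp; try apply Hf; auto; lia.
    + apply is_RInt_ext with (p (S n)); [| apply (RInt_correct (p _)), Hp; lia].
      pose proof (Ha (S n) ltac:(lia)).
      rewrite Rmin_left, Rmax_right by lra.
      intros x Hx; symmetry; apply Hf; auto; lia.
Qed.

(** Here [I i] is the integral of piece [i], [J i] that of its inverse, and there are [n + 1]
    pieces. Each [I i + J i] with [2 <= i <= n] is a difference of boundary terms, and the jump sum
    cancels all of these except one at [a 2] and one at [a (S n)]. *)
Lemma piecewise_telescope (a : nat -> R) (p : nat -> R -> R) (I J : nat -> R)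
    (n : nat) :
  (1 <= n)%nat ->
  (forall i, (2 <= i <= n)%nat ->
     J i = a (S i) * p i (a (S i)) - a i * p i (a i) - I i) ->
  sum_n_m I 1 (S n) + sum_n_m J 2 n
  + sum_n_m (fun i => a i * (p i (a i) - p (i - 1)%nat (a i))) 2 (S n)
  = I 1%nat + I (S n) + a (S n) * p (S n) (a (S n))
    - a 2%nat * p 1%nat (a 2%nat).
Proof.
  intros Hn; induction Hn as [| n Hn IH]; intros HJ.
  - rewrite (sum_n_m_zero J) by lia.
    rewrite sum_n_Sm, !sum_n_n by lia.
    unfold plus, zero; simpl; ring.
  - rewrite (sum_n_Sm I), (sum_n_Sm J), (sum_n_Sm (fun i => _ i * _)) by lia.
    unfold plus; simpl.
    rewrite (HJ (S n)) by lia.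
    assert (E := IH ltac:(intros; apply HJ; lia)).
    simpl in *; lra.
Qed.

(* Applying the identity [RInt_inverse_on] to every piece, all interior
   contributions cancel and only the two end corrections remain. *)
Lemma young_F_ends (m : nat) (a : nat -> R) (p : nat -> R -> R) (f : R -> R)
    (c1 cm : R) :
  (1 <= m)%nat ->
  (forall i, (1 <= i <= m)%nat -> a i < a (S i)) ->
  (forall i, (1 <= i <= m)%nat ->
     continuous_on (fun x => a i <= x <= a (S i)) (p i)) ->
  (forall i, (1 <= i <= m)%nat -> strictly_monotone_on (a i) (a (S i)) (p i)) ->
  (forall i x, (1 <= i <= m)%nat -> a i < x < a (S i) -> f x = p i x) ->
  a 1%nat <= c1 <= a 2%nat -> a m <= cm <= a (S m) ->
  young_F m a p f (p 1%nat c1) (p m cm) =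
    (RInt (p 1%nat) (a 1%nat) c1 - (c1 - a 1%nat) * p 1%nat c1)
    + (RInt (p m) cm (a (S m)) - (a (S m) - cm) * p m cm).
Proof.
  intros Hm Ha Hc Hmon Hf H1 H2.
  assert (Hex : forall i u v, (1 <= i <= m)%nat -> a i <= u <= a (S i) ->
            a i <= v <= a (S i) -> ex_RInt (p i) u v)
    by (intros i u v Hi; apply ex_RInt_continuous_on; auto).
  assert (Hch : forall i u v w, (1 <= i <= m)%nat -> a i <= u <= a (S i) ->
            a i <= v <= a (S i) -> a i <= w <= a (S i) ->
            RInt (p i) u w = RInt (p i) u v + RInt (p i) v w)
    by (intros i u v w; intros; symmetry;
        apply (RInt_Chasles (p i)); apply Hex; auto).
  assert (Hinv : forall i u v, (1 <= i <= m)%nat -> a i <= u <= a (S i) ->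
            a i <= v <= a (S i) ->
            RInt (piece_inv a p i) (p i u) (p i v)
            = v * p i v - u * p i u - RInt (p i) u v)
    by (intros i u v Hi; apply RInt_inverse_on; auto).
  assert (Hf' := RInt_piecewise m a p f Hm Ha).
  assert (Hle : forall i, (1 <= i <= m)%nat -> a i <= a (S i))
    by (intros i Hi; apply Rlt_le, Ha, Hi).
  assert (HRf := is_RInt_unique f _ _ _
    (Hf' ltac:(intros i Hi; pose proof (Hle i Hi); apply Hex; auto; lra) Hf)).
  unfold young_F; rewrite HRf; clear HRf Hf'.
  unfold RInt_piecewise_inv.
  (* With one piece, [c1] and [cm] lie in the same interval in either order; oriented additivity of
     the integral covers both. *)
  destruct (Nat.eqb_spec m 1) as [-> | Hm1].
  - rewrite (sum_n_m_zero (fun i => a i * _)), sum_n_n by lia.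
    pose proof (Hle 1%nat ltac:(lia)).
    rewrite Hinv by (auto; lia).
    rewrite (Hch 1%nat (a 1%nat) c1 (a 2%nat)) by (lia || lra).
    rewrite (Hch 1%nat c1 cm (a 2%nat)) by (lia || lra).
    unfold zero; simpl; ring.
  - destruct m as [| n]; [lia |].
    replace (S n - 1)%nat with n by lia.
    pose proof (Hle 1%nat ltac:(lia)); pose proof (Hle (S n) ltac:(lia)).
    assert (E := piecewise_telescope a p
      (fun i => RInt (p i) (a i) (a (S i)))
      (fun i => RInt (piece_inv a p i) (p i (a i)) (p i (a (S i)))) n
      ltac:(lia)
      ltac:(intros i Hi; pose proof (Hle i ltac:(lia)); apply Hinv; lia || lra)).
    cbv beta in E.
    rewrite (Hinv 1%nat c1 (a 2%nat)) by (lia || lra).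
    rewrite (Hinv (S n) (a (S n)) cm) by (lia || lra).
    rewrite (Hch 1%nat (a 1%nat) c1 (a 2%nat)) in E by (lia || lra).
    rewrite (Hch (S n) (a (S n)) cm (a (S (S n)))) in E by (lia || lra).
    (* Convertible but syntactically different monoid structures on the reals are made identical, so
       that [lra] recognises equal sums. *)
    change (CompleteNormedModule.AbelianMonoid R_AbsRing
              R_CompleteNormedModule) with R_AbelianMonoid.
    lra.
Qed.

(** * The four monotonicity cases and equality *)

Theorem theorem2p8 :
  forall (m : nat) (a : nat -> R) (p : nat -> R -> R) (f : R -> R) (b1 bm1 : R),
    (1 <= m)%nat ->
    (forall i : nat, (1 <= i <= m)%nat -> a i < a (S i)) ->
    (forall i : nat, (1 <= i <= m)%nat ->
       continuous_on (fun x : R => a i <= x <= a (S i)) (p i)) ->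
    (forall i : nat, (1 <= i <= m)%nat ->
       strictly_monotone_on (a i) (a (S i)) (p i)) ->
    is_piecewise m a p f ->
    in_image (a 1%nat) (a 2%nat) (p 1%nat) b1 ->
    in_image (a m) (a (S m)) (p m) bm1 ->
    let F := young_F m a p f b1 bm1 in
    let K1 := (a 1%nat - piece_inv a p 1 b1) * (f (a 1%nat) - b1) in
    let Km1 := (a (S m) - piece_inv a p m bm1) * (f (a (S m)) - bm1) in
    let at_endpoints := b1 = f (a 1%nat) /\ bm1 = f (a (S m)) in
    let inc1 := strictly_increasing_on (a 1%nat) (a 2%nat) (p 1%nat) in
    let dec1 := strictly_decreasing_on (a 1%nat) (a 2%nat) (p 1%nat) in
    let incm := strictly_increasing_on (a m) (a (S m)) (p m) in
    let decm := strictly_decreasing_on (a m) (a (S m)) (p m) in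
    (inc1 -> incm ->
       - K1 <= F <= Km1 /\
       (- K1 = F <-> at_endpoints) /\ (F = Km1 <-> at_endpoints)) /\
    (dec1 -> decm ->
       Km1 <= F <= - K1 /\
       (Km1 = F <-> at_endpoints) /\ (F = - K1 <-> at_endpoints)) /\
    (inc1 -> decm ->
       Km1 - K1 <= F <= 0 /\
       (Km1 - K1 = F <-> at_endpoints) /\ (F = 0 <-> at_endpoints)) /\
    (dec1 -> incm ->
       0 <= F <= Km1 - K1 /\
       (0 = F <-> at_endpoints) /\ (F = Km1 - K1 <-> at_endpoints)).
Proof.
  intros m a p f b1 bm1 Hm Ha Hc Hmon [Hf [Hf1 Hfm]] Hb1 Hbm
    F K1 Km1 at_endpoints inc1 dec1 incm decm.
  destruct (inverse_on_spec _ _ _ _ Hb1) as [Hc1 E1].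
  destruct (inverse_on_spec _ _ _ _ Hbm) as [Hcm Em].
  fold (piece_inv a p 1) in Hc1, E1; fold (piece_inv a p m) in Hcm, Em.
  set (c1 := piece_inv a p 1 b1) in *; set (cm := piece_inv a p m bm1) in *.
  pose proof (Ha 1%nat ltac:(lia)) as L1; pose proof (Ha m ltac:(lia)) as Lm.
  assert (HF := young_F_ends m a p f c1 cm Hm Ha Hc Hmon Hf Hc1 Hcm).
  rewrite E1, Em in HF; fold F in HF.
  set (A := RInt (p 1%nat) (a 1%nat) c1 - (c1 - a 1%nat) * b1) in HF.
  set (B := RInt (p m) cm (a (S m)) - (a (S m) - cm) * bm1) in HF.
  assert (HA0 : c1 = a 1%nat -> A = 0 /\ K1 = 0 /\ b1 = f (a 1%nat)).
  { intros E; unfold A, K1; rewrite E, RInt_point, Hf1, <- E1, E.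
    unfold zero; simpl; repeat split; ring. }
  assert (HB0 : cm = a (S m) -> B = 0 /\ Km1 = 0 /\ bm1 = f (a (S m))).
  { intros E; unfold B, Km1; rewrite E, RInt_point, Hfm, <- Em, E.
    unfold zero; simpl; repeat split; ring. }
  (* At a nondegenerate end, injectivity of the piece rules out the endpoint value, matching the
     strict bounds that follow. *)
  assert (HA1 : a 1%nat < c1 -> b1 <> f (a 1%nat)).
  { intros L E; rewrite Hf1, <- E1 in E.
    apply (strictly_monotone_on_inj (a 1%nat) (a 2%nat)) in E;
      [lra | apply Hmon; lia | lra | lra]. }
  assert (HB1 : cm < a (S m) -> bm1 <> f (a (S m))).
  { intros L E; rewrite Hfm, <- Em in E.
    apply (strictly_monotone_on_inj (a m) (a (S m))) in E;
      [lra | apply Hmon; lia | lra | lra]. }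
  assert (HAi : inc1 -> a 1%nat < c1 -> - K1 < A < 0).
  { intros Hi L.
    pose proof (RInt_increasing_on_bounds (a 1%nat) (a 2%nat) (a 1%nat) c1
      (p 1%nat) (Hc 1%nat ltac:(lia)) Hi ltac:(lra) L ltac:(lra)).
    rewrite E1 in *; unfold A, K1; rewrite Hf1; lra. }
  assert (HAd : dec1 -> a 1%nat < c1 -> 0 < A < - K1).
  { intros Hd L.
    pose proof (RInt_decreasing_on_bounds (a 1%nat) (a 2%nat) (a 1%nat) c1
      (p 1%nat) (Hc 1%nat ltac:(lia)) Hd ltac:(lra) L ltac:(lra)).
    rewrite E1 in *; unfold A, K1; rewrite Hf1; lra. }
  assert (HBi : incm -> cm < a (S m) -> 0 < B < Km1).
  { intros Hi L.
    pose proof (RInt_increasing_on_bounds (a m) (a (S m)) cm (a (S m))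
      (p m) (Hc m ltac:(lia)) Hi ltac:(lra) L ltac:(lra)).
    rewrite Em in *; unfold B, Km1; rewrite Hfm; lra. }
  assert (HBd : decm -> cm < a (S m) -> Km1 < B < 0).
  { intros Hd L.
    pose proof (RInt_decreasing_on_bounds (a m) (a (S m)) cm (a (S m))
      (p m) (Hc m ltac:(lia)) Hd ltac:(lra) L ltac:(lra)).
    rewrite Em in *; unfold B, Km1; rewrite Hfm; lra. }
  (* Only linear facts about [F = A + B] remain. If some end is nondegenerate, the bounds are strict
     and [at_endpoints] fails, so both sides of every equivalence are false; if both ends are
     degenerate, [A], [B], [K1] and [Km1] all vanish. *)
  clearbody F K1 Km1 A B inc1 dec1 incm decm; unfold at_endpoints.
  destruct (Rle_lt_or_eq_dec _ _ (proj1 Hc1)) as [Q1 | Q1];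
    [specialize (HA1 Q1); clear HA0
    | destruct (HA0 (eq_sym Q1)) as [? [? ?]]; clear HA1 HAi HAd];
  (destruct (Rle_lt_or_eq_dec _ _ (proj2 Hcm)) as [Qm | Qm];
    [specialize (HB1 Qm); clear HB0
    | destruct (HB0 Qm) as [? [? ?]]; clear HB1 HBi HBd]);
  repeat split; intros;
  repeat match goal with
    | H : _ /\ _ |- _ => destruct H
    | H : inc1 -> _, H' : inc1 |- _ => specialize (H H' Q1)
    | H : dec1 -> _, H' : dec1 |- _ => specialize (H H' Q1)
    | H : incm -> _, H' : incm |- _ => specialize (H H' Qm)
    | H : decm -> _, H' : decm |- _ => specialize (H H' Qm)
  end; try contradiction; lra.
Qed.
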